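(* Let $(\mathcal{X},\rho)$ be a Polish space, let $T=\mathbb{N}_+=\{1,2,\dots\}$, and let $\{P_t\}_{t\in T}$ be a Markov semigroup of regular Markov operators on $\mathcal{X}$. Then $\{P_t\}_{t\in T}$ satisfies the e-property (at every point of $\mathcal{X}$) if and only if it is a Markov-Feller semigroup and satisfies the eventual e-property (at every point of $\mathcal{X}$).
   Context: Notation: $\mathcal{M}(\mathcal{X})$ is the family of finite Borel measures on $\mathcal{X}$; $B_b(\mathcal{X})$, $C_b(\mathcal{X})$, $L_b(\mathcal{X})$ are the spaces of bounded Borel, bounded continuous, and bounded Lipschitz real-valued functions on $\mathcal{X}$, respectively; $\langle f,\mu\rangle=\int_{\mathcal X} f\,d\mu$. A Markov operator is a map $P:\mathcal{M}(\mathcal{X})\to\mathcal{M}(\mathcal{X})$ with $P(\lambda_1\mu_1+\lambda_2\mu_2)=\lambda_1P\mu_1+\lambda_2P\mu_2$ for $\lambda_1,\lambda_2\ge0$, $\mu_1,\mu_2\in\mathcal M(\mathcal X)$, and $P\mu(\mathcal{X})=\mu(\mathcal{X})$. It is regular if there is a linear operator on $B_b(\mathcal{X})$, also denoted $P$, with $\langle f,P\mu\rangle=\langle Pf,\mu\rangle$ for all $f\in B_b(\mathcal{X})$, $\mu\in\mathcal{M}(\mathcal{X})$. It is Markov-Feller if it is regular and $P(C_b(\mathcal{X}))\subset C_b(\mathcal{X})$. A Markov semigroup is a semigroup $\{P_t\}_{t\in T}$ ($P_{s+t}=P_sP_t$) of Markov operators; it is a Markov-Feller semigroup if every $P_t$,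 $t\in T$, is Markov-Feller. E-property at $z$: for every $f\in L_b(\mathcal{X})$, $\limsup_{x\to z}\sup_{t\in T}|P_tf(x)-P_tf(z)|=0$. Eventual e-property at $z$: for every $f\in L_b(\mathcal{X})$, $\limsup_{(x,t)\to(z,\infty)}|P_tf(x)-P_tf(z)|=0$; that is, for every $\epsilon>0$ there exist $\delta>0$ and $t_0\in T$ such that $|P_tf(x)-P_tf(z)|<\epsilon$ for all $x$ with $\rho(x,z)<\delta$ and all $t\ge t_0$. *)

(* Defs.v *)
From HB Require Import structures.
From mathcomp Require Import all_boot all_order all_algebra.
From mathcomp Require Import all_classical all_reals all_analysis.

Set Implicit Arguments.
Unset Strict Implicit.
Unset Printing Implicit Defensive.

Import Order.TTheory GRing.Theory Num.Theory.
Import numFieldNormedType.Exports.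

Local Open Scope classical_set_scope.
Local Open Scope ring_scope.

HB.mixin Record isSeparable T & Topological T := {
  separable : exists2 D : set T, countable D & dense D
}.

(* A complete separable metric space.  [Complete] makes it pointed, hence
   nonempty. *)
#[short(type="polishType")]
HB.structure Definition Polish (R : numDomainType) :=
  {T of Complete T & Metric R T & isSeparable T}.

Notation borel X := (g_sigma_algebraType (@open X)).

(* Two such measures represent the same Borel measure when they agree on the
   Borel sets: their values elsewhere are arbitrary, so equations between
   measures are stated on Borel sets only. *)
Notation fin_borel_measure R X := {finite_measure set (borel X) -> \bar R}.

Section FunctionSpaces.
Context (R : realType) (X : polishType R).

Definition Bb : set (X -> R) :=
  [set f : X -> R | measurable_fun [set: borel X] f /\ bounded_fun f].

Definition Cb : set (X -> R) := [set f : X -> R | continuous f /\ bounded_fun f].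

Definition Lb : set (X -> R) :=
  [set f : X -> R | (exists k : R, forall x y : X, `|f x - f y| <= k * mdist x y)
           /\ bounded_fun f].

End FunctionSpaces.

Section Operators.
Context (R : realType) (X : polishType R).
Local Notation M := (fin_borel_measure R X).
Local Notation F := (X -> R).

(* mu = l1 mu1 + l2 mu2 *)
Definition is_comb (l1 l2 : R) (mu1 mu2 mu : M) : Prop :=
  forall A : set (borel X), measurable A ->
    mu A = (l1%:E * mu1 A + l2%:E * mu2 A)%E.

(* The case l1 = 1, l2 = 0 of additivity says that [P] is compatible with
   equality on Borel sets. *)
Definition markov_operator (P : M -> M) : Prop :=
  (forall (l1 l2 : R) (mu1 mu2 mu : M), 0 <= l1 -> 0 <= l2 ->
     is_comb l1 l2 mu1 mu2 mu -> is_comb l1 l2 (P mu1) (P mu2) (P mu)) /\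
  (forall mu : M, P mu [set: X] = mu [set: X]).

Definition pairing (f : F) (mu : M) : R := \int[mu]_x f x.

(* [U] is a linear operator on Bb dual to [P]; its values outside Bb are
   irrelevant.  The restriction of [U] to Bb is determined by [P], since
   U f x is the pairing of f with the image by P of the Dirac mass at x. *)
Definition dual_operator (P : M -> M) (U : F -> F) : Prop :=
  [/\ forall f, Bb f -> Bb (U f),
      forall (a b : R) f g, Bb f -> Bb g ->
        U (fun x => a * f x + b * g x) = (fun x => a * U f x + b * U g x)
    & forall f (mu : M), Bb f -> pairing f (P mu) = pairing (U f) mu].

Definition markov_feller (P : M -> M) : Prop :=
  markov_operator P /\
  exists U, dual_operator P U /\ forall f, Cb f -> Cb (U f).

(* Semigroups are indexed by the positive integers: nothing is assumed about
   index 0. *)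
Definition markov_semigroup (P : nat -> M -> M) : Prop :=
  (forall t, (0 < t)%N -> markov_operator (P t)) /\
  (forall s t, (0 < s)%N -> (0 < t)%N ->
     forall (mu : M) (A : set (borel X)), measurable A ->
       P (s + t)%N mu A = P s (P t mu) A).

Definition markov_feller_semigroup (P : nat -> M -> M) : Prop :=
  markov_semigroup P /\ forall t, (0 < t)%N -> markov_feller (P t).

(* The limit superior is over full neighbourhoods of [z]: including x = z,
   where the supremum is 0, keeps the value 0 when [z] is isolated. *)
Definition e_property (U : nat -> F -> F) (z : X) : Prop :=
  forall f, Lb f ->
    limf_esup (fun x : X => ereal_sup
      [set (`|U t f x - U t f z|)%:E | t in [set t | (0 < t)%N]]) (nbhs z)
    = 0%E.

Definition eventual_e_property (U : nat -> F -> F) (z : X) : Prop :=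
  forall f, Lb f -> forall eps : R, 0 < eps ->
    exists delta : R, exists t0 : nat, [/\ 0 < delta, (0 < t0)%N &
      forall (x : X) (t : nat), mdist x z < delta -> (t0 <= t)%N ->
        `|U t f x - U t f z| < eps].

End Operators.

(* Main.v *)
Require Import Defs.
From mathcomp Require Import all_boot all_order all_algebra.
From mathcomp Require Import all_classical all_reals all_analysis.
From mathcomp Require Import measurable_realfun lra.

(**
  Only one implication has content beyond unfolding suprema: the e-property
  controls [U t] on bounded Lipschitz functions, while the Feller property asks
  for continuity of [U t f] for every bounded continuous [f].

  The bridge is that [U t] is given by a kernel, [U t f x] being the integral of
  [f] against the image of the Dirac mass at [x] ([dual_operatorE]); hence
  it is monotone, and continuous along bounded pointwise convergent sequences.
  A bounded continuous [f] is the increasing limit of its Lipschitz envelopes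
  [f_n x = inf_y (f y + n d(x, y))] ([envelope_cvg]), so [U t f] is the supremum
  of the continuous functions [U t f_n] and is therefore lower semicontinuous
  ([dual_operator_lsc]). The same applied to [- f] gives continuity
  ([dual_operator_Cb]). The eventual e-property holds with threshold time 1.

  Conversely, near [z] the eventual e-property takes care of all times beyond
  some [t0]; the finitely many remaining times are handled by the continuity of
  [U t f] at [z], finitely many neighbourhoods being intersected. The Feller
  property speaks of some dual operator of [P t], but a dual operator is
  determined on bounded Borel functions, so it holds of the given [U t] as well
  ([markov_feller_Cb]).
*)

Set Implicit Arguments.
Unset Strict Implicit.
Unset Printing Implicit Defensive.

Import Order.TTheory GRing.Theory Num.Theory.
Import numFieldNormedType.Exports.

Local Open Scope classical_set_scope.
Local Open Scope ring_scope.

(** * Boundedness and limits superior *)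

Lemma bounded_funP (R : realType) (T : Type) (f : T -> R) :
  bounded_fun f <-> exists M, forall x, `|f x| <= M.
Proof.
split=> [[M [_ fM]]|[M fM]].
  by exists (M + 1) => x; apply: fM; rewrite ?ltrDl.
exists M; split=> [|N MN x _]; first exact: num_real.
exact: le_trans (fM x) (ltW MN).
Qed.

(** For nonnegative functions a vanishing limit superior is a smallness
    condition with a single quantifier over neighbourhoods, which is how both
    directions of the theorem use the e-property. *)
Lemma limf_esup_eq0P (R : realType) (T : choiceType) (X : filteredType T)
    (g : X -> \bar R) (F : set_system X) :
    ProperFilter F -> (forall x, 0 <= g x)%E ->
  limf_esup g F = 0%E <->
  (forall e : R, 0 < e -> \forall x \near F, (g x <= e%:E)%E).
Proof.
move=> FF g0; split=> [gF0 e e0|gF].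
  have : (limf_esup g F < e%:E)%E by rewrite gF0 lte_fin.
  rewrite limf_esupE => /ereal_inf_lt[_ [V FV <-]] Ve.
  apply: filterS FV => x Vx; apply: le_trans (ltW Ve).
  by apply: ereal_sup_ubound; exists x.
apply/eqP; rewrite eq_le; apply/andP; split; last first.
  by apply: limf_esup_ge0 => //; exact: filter_not_empty.
apply/lee_addgt0Pr => e e0; rewrite add0e limf_esupE.
apply: ge_ereal_inf; exists (ereal_sup [set g x | x in [set x | (g x <= e%:E)%E]]).
  by exists [set x | (g x <= e%:E)%E] => //; exact: gF.
by apply: ge_ereal_sup => _ [x gx <-].
Qed.

(** * Lipschitz approximation from below in a metric space *)

Section MetricFunctions.
Context (R : realType) (X : metricType R).
Implicit Types (f : X -> R) (x y z : X).

Lemma near_mdistP z (Q : X -> Prop) :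
  (\forall x \near z, Q x) <->
  exists2 d : R, 0 < d & forall x, mdist x z < d -> Q x.
Proof.
split=> [/nbhs_ballP[d /= d0 dQ]|[d d0 dQ]].
  by exists d => // x xz; apply: dQ; rewrite ballEmdist /= metric_sym.
apply/nbhs_ballP; exists d => //= x.
by rewrite ballEmdist /= metric_sym => /dQ.
Qed.

Lemma mcontinuousP f z :
  {for z, continuous f} <->
  (forall e : R, 0 < e -> exists2 d : R, 0 < d &
     forall x, mdist x z < d -> `|f x - f z| < e).
Proof.
split=> [/cvgrPdist_lt fz e /fz/near_mdistP[d d0 fd]|fz].
  by exists d => // x /fd; rewrite distrC.
apply/cvgrPdist_lt => e /fz[d d0 fd]; apply/near_mdistP.
by exists d => // x /fd; rewrite distrC.
Qed.

Lemma lipschitz_mcontinuous f (k : R) :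
  (forall x y, `|f x - f y| <= k * mdist x y) -> continuous f.
Proof.
move=> fk z; apply/mcontinuousP => e e0.
(* [k] may be zero or negative; `|k| + 1 is a positive Lipschitz constant. *)
have k0 : 0 < `|k| + 1 by rewrite ltr_wpDl.
exists (e / (`|k| + 1)) => [|x xz]; first exact: divr_gt0.
apply: le_lt_trans (fk x z) _; apply: (@le_lt_trans _ _ ((`|k| + 1) * mdist x z)).
  by rewrite ler_wpM2r ?mdist_ge0// (le_trans (ler_norm _))// lerDl.
by rewrite mulrC -ltr_pdivlMr.
Qed.

(** The Pasch-Hausdorff envelope: for [f] bounded below, the largest function
    below [f] that is Lipschitz with constant [n]. *)
Definition envelope f (n : nat) x : R :=
  inf (range (fun y => f y + n%:R * mdist x y)).

Section Envelope.
Variables (f : X -> R) (m : R).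
Hypothesis fm : forall y, m <= f y.

Let lbE n x : lbound (range (fun y => f y + n%:R * mdist x y)) m.
Proof.
move=> _ [y _ <-]; apply: le_trans (fm y) _.
by rewrite lerDl mulr_ge0// mdist_ge0.
Qed.

Lemma envelope_le_at n x y : envelope f n x <= f y + n%:R * mdist x y.
Proof. by apply: ge_inf; [exists m; exact: lbE|exists y]. Qed.

Lemma le_envelope n x (c : R) :
  (forall y, c <= f y + n%:R * mdist x y) -> c <= envelope f n x.
Proof.
move=> cf; apply: lb_le_inf; first by exists (f x + n%:R * mdist x x), x.
by move=> _ [y _ <-].
Qed.

Lemma envelope_ge n x : m <= envelope f n x.
Proof. by apply: le_envelope => y; apply: (@lbE n x); exists y. Qed.

Lemma envelope_le n x : envelope f n x <= f x.
Proof. by have := envelope_le_at n x x; rewrite mdistxx mulr0 addr0. Qed.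

(** An infimum of functions of [x] that are all Lipschitz with constant [n]. *)
Lemma envelope_lipschitz n x y :
  `|envelope f n x - envelope f n y| <= n%:R * mdist x y.
Proof.
have half u v : envelope f n u - n%:R * mdist u v <= envelope f n v.
  apply: le_envelope => w; rewrite lerBlDr.
  apply: le_trans (envelope_le_at n u w) _.
  by rewrite -addrA lerD2l -mulrDr ler_wpM2l// addrC metric_triangle.
rewrite ler_norml; apply/andP; split.
  have := half y x; rewrite (metric_sym y x); lra.
have := half x y; lra.
Qed.

(** Points [y] near [x] contribute values close to [f x] by continuity; those at
    distance at least [d] pay a penalty [n * d], which for large [n] makes up for
    the gap between [f x] and the lower bound [m]. *)
Lemma envelope_cvg x : {for x, continuous f} ->
  envelope f n x @[n --> \oo] --> f x.
Proof.
move=> /mcontinuousP fx; apply/cvgrPdist_le => e e0.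
have [d d0 fd] := fx _ e0.
near=> n.
rewrite ger0_norm ?subr_ge0 ?envelope_le// lerBlDl -lerBlDr.
apply: le_envelope => y; have [yx|xy] := ltP (mdist y x) d.
  have := fd _ yx; rewrite ltr_norml => /andP[+ _].
  have : 0 <= n%:R * mdist x y by rewrite mulr_ge0// mdist_ge0.
  lra.
have : f x - m <= n%:R * mdist x y.
  apply: (@le_trans _ _ (n%:R * d)); last by rewrite ler_wpM2l// metric_sym.
  rewrite -ler_pdivrMr//.
  by near: n; exact: nbhs_infty_ger.
have := fm y; lra.
Unshelve. all: by end_near. Qed.

End Envelope.
End MetricFunctions.

(** * Operators dual to a map on finite measures *)

Section DualOperators.
Context (R : realType) (X : polishType R).
Local Notation M := (fin_borel_measure R X).
Implicit Types (f g : X -> R) (mu : M).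

Lemma continuous_borel_measurable f :
  continuous f -> measurable_fun [set: borel X] f.
Proof.
move=> /continuousP cf.
apply: (measurability _ (RGenOpens.measurableE R)).
move=> _ [_ [a [b ->] <-]]; rewrite setTI; apply: sub_sigma_algebra.
exact/cf/interval_open.
Qed.

Lemma Cb_Bb f : Cb f -> Bb f.
Proof. by move=> [cf bf]; split => //; exact: continuous_borel_measurable. Qed.

Lemma Lb_Cb f : Lb f -> Cb f.
Proof. by move=> [[k fk] bf]; split => //; exact: lipschitz_mcontinuous fk. Qed.

Lemma envelope_Lb f (M0 : R) n : (forall x, `|f x| <= M0) -> Lb (envelope f n).
Proof.
move=> fM.
have fm x : - M0 <= f x by have := fM x; rewrite ler_norml => /andP[].
split; first by exists n%:R; exact: envelope_lipschitz fm n.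
apply/bounded_funP; exists M0 => x; rewrite ler_norml envelope_ge//=.
apply: le_trans (envelope_le fm n x) _.
by have := fM x; rewrite ler_norml => /andP[].
Qed.

Lemma Bb_integrable f mu : Bb f -> mu.-integrable setT (EFin \o f).
Proof.
move=> [mf bf]; apply: measurable_bounded_integrable => //.
by rewrite ltey_eq fin_num_measure.
Qed.

Lemma pairing_dirac f (x : X) : Bb f -> pairing f (dirac (x : borel X) : M) = f x.
Proof.
move=> [mf _]; rewrite /pairing /Rintegral integral_dirac//; last exact/measurable_EFinP.
by rewrite diracE mem_set// mul1e.
Qed.

Lemma le_pairing f g mu : Bb f -> Bb g -> (forall x, f x <= g x) ->
  pairing f mu <= pairing g mu.
Proof. by move=> bf bg fg; apply: le_Rintegral => //; exact: Bb_integrable. Qed.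

(** Dominated convergence, with a constant as integrable bound since the measure
    is finite. *)
Lemma pairing_cvg (f_ : nat -> X -> R) f (M0 : R) mu :
    (forall n, Bb (f_ n)) -> Bb f -> (forall n x, `|f_ n x| <= M0) ->
    (forall x, f_ n x @[n --> \oo] --> f x) ->
  pairing (f_ n) mu @[n --> \oo] --> pairing f mu.
Proof.
move=> bf_ bf fM f_f; apply: fine_cvg.
rewrite fineK; last exact/integrable_fin_num/Bb_integrable.
apply: (@dominated_cvg _ _ _ mu setT measurableT _ _ (cst M0%:E)) => //.
- by move=> n; apply/measurable_EFinP; have [] := bf_ n.
- by move=> x _; apply: cvg_EFin; [exact: nearW|exact: f_f].
- by apply: finite_measure_integrable_cst.
- by move=> n x _; rewrite /= lee_fin.
Qed.

Section Dual.
Variables (P : M -> M) (U : (X -> R) -> (X -> R)).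
Hypothesis PU : dual_operator P U.

(** Duality tested on Dirac masses: a dual operator is an integral operator, and
    it is determined by [P] on bounded Borel functions. *)
Lemma dual_operatorE f (x : X) : Bb f -> U f x = pairing f (P (dirac (x : borel X))).
Proof.
by case: PU => UB _ dPU bf; rewrite dPU// pairing_dirac//; exact: UB.
Qed.

Lemma dual_operatorN f : Bb f -> U (- f) = - U f.
Proof.
case: PU => _ /(_ (-1) 0 f f) + _ => /[swap] bf => /(_ bf bf).
have -> h : (fun x : X => -1 * h x + 0 * h x) = - h :> (X -> R).
  by apply/funext => x; rewrite mulN1r mul0r addr0.
by rewrite (_ : (fun x => _) = - U f)//; apply/funext => x; rewrite mulN1r mul0r addr0.
Qed.

Hypothesis UL : forall f, Lb f -> continuous (U f).

(** One envelope [f_n] suffices: [U f_n z] is within [e / 2] of [U f z] for large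
    [n], and [U f_n], which is continuous, lies below [U f] everywhere. *)
Lemma dual_operator_lsc f (z : X) (e : R) : Cb f -> 0 < e ->
  \forall x \near z, U f z - e < U f x.
Proof.
move=> [cf bf] e0; have /bounded_funP[M0 fM] := bf.
have fm x : - M0 <= f x by have := fM x; rewrite ler_norml => /andP[].
have bBf : Bb f by exact: Cb_Bb.
have bBe n : Bb (envelope f n) by exact/Cb_Bb/Lb_Cb/envelope_Lb/fM.
have : U (envelope f n) z @[n --> \oo] --> U f z.
  rewrite dual_operatorE//.
  under eq_fun do rewrite dual_operatorE//.
  apply: (@pairing_cvg _ _ M0) => // [n x|x]; last exact/envelope_cvg/cf/fm.
  rewrite ler_norml envelope_ge//= (le_trans (envelope_le fm n x))//.
  by have := fM x; rewrite ler_norml => /andP[].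
have e20 : 0 < e / 2 by exact: divr_gt0.
move=> /cvgrPdist_lt/(_ _ e20)[n _ /(_ n (leqnn n))] /=.
rewrite ltr_norml => /andP[_ Ufz].
have /UL/(_ z)/cvgrPdist_lt/(_ _ e20) : Lb (envelope f n) by exact: envelope_Lb fM.
apply: filterS => x; rewrite ltr_norml => /andP[_ Uex].
have : U (envelope f n) x <= U f x.
  by rewrite !dual_operatorE//; apply: le_pairing => // y; exact: envelope_le.
lra.
Qed.

(** Lower semicontinuity of both [U f] and [U (- f) = - U f]. *)
Lemma dual_operator_Cb f : Cb f -> Cb (U f).
Proof.
move=> cbf; have bBf := Cb_Bb cbf.
have cbNf : Cb (- f).
  case: cbf => cf bf; split; last exact: bounded_funN.
  by move=> x; apply: cvgN; exact: cf.
split; last by case: PU => /(_ _ bBf)[].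
move=> z; apply/cvgrPdist_lt => e e0.
have := dual_operator_lsc z cbNf e0; have := dual_operator_lsc z cbf e0.
apply: filterS2 => x; rewrite dual_operatorN//= !fctE ltr_norml.
by move=> ? ?; apply/andP; split; lra.
Qed.

End Dual.

Lemma markov_feller_Cb (P : M -> M) (U : (X -> R) -> (X -> R)) f :
  dual_operator P U -> markov_feller P -> Cb f -> Cb (U f).
Proof.
move=> PU [_ [V [PV VC]]] cbf; have bBf := Cb_Bb cbf.
suff -> : U f = V f by exact: VC.
by apply/funext => x; rewrite (dual_operatorE PU)// (dual_operatorE PV).
Qed.

(** * The two forms of the e-property *)

Lemma e_propertyP (U : nat -> (X -> R) -> (X -> R)) (z : X) :
  e_property U z <->
  forall f, Lb f -> forall e : R, 0 < e -> \forall x \near z,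
    forall t, (0 < t)%N -> `|U t f x - U t f z| <= e.
Proof.
have g0 f (x : X) : (0 <= ereal_sup
    [set (`|U t f x - U t f z|)%:E | t in [set t | (0 < t)%N]])%E.
  apply: le_ereal_sup_tmp; exists (`|U 1 f x - U 1 f z|)%:E; first by exists 1%N.
  by rewrite lee_fin.
split=> eU f Lf.
  move=> e e0; have /limf_esup_eq0P := eU f Lf.
  move=> /(_ (g0 f) e e0); apply: filterS => x xe t t0.
  by rewrite -lee_fin; apply: le_trans xe; apply: ereal_sup_ubound; exists t.
apply/limf_esup_eq0P => [//|e e0].
apply: filterS (eU f Lf e e0) => x xe.
by apply: ge_ereal_sup => _ [t t0 <-]; rewrite lee_fin; exact: xe.
Qed.

End DualOperators.

Theorem proposition3p1 (R : realType) (X : polishType R)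
    (P : nat -> fin_borel_measure R X -> fin_borel_measure R X)
    (U : nat -> (X -> R) -> (X -> R))
    (hP : markov_semigroup P)
    (hU : forall t : nat, (0 < t)%N -> dual_operator (P t) (U t)) :
  (forall z : X, e_property U z) <->
  markov_feller_semigroup P /\ (forall z : X, eventual_e_property U z).
Proof.
split=> [eU|[[_ PF] evU] z].
  split; last first.
    move=> z f Lf e e0.
    (* Halving turns the weak inequality of [e_propertyP] into a strict one. *)
    have e20 : 0 < e / 2 by exact: divr_gt0.
    have /near_mdistP[d d0 dU] := (e_propertyP U z).1 (eU z) f Lf _ e20.
    exists d, 1%N; split=> // x t xz t1.
    apply: le_lt_trans (dU x xz t t1) _.
    by rewrite ltr_pdivrMr// ltr_pMr// ltr1n.
  split=> // t t0; split; first by case: hP => /(_ t t0).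
  exists (U t); split; first exact: hU.
  move=> f; apply: (dual_operator_Cb (hU t t0)) => {}f Lf z.
  apply/cvgrPdist_le => e e0.
  apply: filterS ((e_propertyP U z).1 (eU z) f Lf e e0) => x /(_ t t0).
  by rewrite distrC.
apply/e_propertyP => f Lf e e0.
have [d [t0 [d0 _ dU]]] := evU z f Lf e e0.
have early : \forall x \near z, forall t : 'I_t0,
    (0 < t)%N -> `|U t f x - U t f z| <= e.
  (* Time 0 satisfies the claim vacuously. *)
  apply: filter_forall => t; have [t_gt0|] := ltnP 0 t; last first.
    by move=> ?; apply: nearW => x.
  have [/(_ z)/cvgrPdist_le/(_ _ e0) Utf _] :=
    markov_feller_Cb (hU t t_gt0) (PF t t_gt0) (Lb_Cb Lf).
  by apply: filterS Utf => x; rewrite distrC.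
have late : \forall x \near z, mdist x z < d by apply/near_mdistP; exists d.
apply: filterS2 late early => x xz xe t t_gt0.
have [tt0|t0t] := ltnP t t0; first exact: (xe (Ordinal tt0)).
exact/ltW/dU.
Qed.
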